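(* If in the plane two non-congruent regular polygons of the same type have a shared vertex, then there are two points in the plane, each of which separately has equal distances to the vertices of the two polygons.
   Context: Two regular polygons are of the same type if they have the same number $n$ of sides. A point $M$ has equal distances to the vertices of two regular $n$-gons if the distances from $M$ to the $n$ vertices of the first polygon are, up to order, the same as the distances from $M$ to the $n$ vertices of the second polygon.
   Formalization: The two points are shown to be distinct exactly when the shared vertex and the two centres are not collinear; in the collinear case they merge into one point, where the claim of two distinct points is false. It is also proved that no other points have equal distances. *)

(* Defs.v *)
From mathcomp Require Import all_boot all_order all_algebra.
From mathcomp Require Import all_classical all_reals all_analysis.

Set Implicit Arguments.
Unset Strict Implicit.
Unset Printing Implicit Defensive.

Import Order.TTheory GRing.Theory Num.Theory.
Local Open Scope classical_set_scope.
Local Open Scope ring_scope.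

Definition plane (R : realType) : Type := (R * R)%type.

(* The library norm on R * R is the sup norm, hence this explicit Euclidean
   distance. *)
Definition dist (R : realType) (A B : plane R) : R :=
  Num.sqrt ((A.1 - B.1) ^+ 2 + (A.2 - B.2) ^+ 2).

(* The vertices are listed counterclockwise.  This loses no generality: the
   notions below depend only on the unordered family of the vertices. *)
Definition regular_ngon (R : realType) (n : nat) (O : plane R)
    (P : 'I_n -> plane R) : Prop :=
  exists r t : R, 0 < r /\
    forall k : 'I_n,
      P k = (O.1 + r * cos (t + 2%:R * pi * k%:R / n%:R),
             O.2 + r * sin (t + 2%:R * pi * k%:R / n%:R)).

Definition isometry (R : realType) (f : plane R -> plane R) : Prop :=
  forall A B : plane R, dist (f A) (f B) = dist A B.

Definition congruent (R : realType) (n : nat) (P Q : 'I_n -> plane R) : Prop :=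
  exists f : plane R -> plane R, isometry f /\ f @` range P = range Q.

Definition distances (R : realType) (n : nat) (M : plane R)
    (P : 'I_n -> plane R) : seq R :=
  [seq dist M (P k) | k <- enum 'I_n].

Definition equal_distances (R : realType) (n : nat) (P Q : 'I_n -> plane R)
    (M : plane R) : Prop :=
  perm_eq (distances M P) (distances M Q).

Definition collinear (R : realType) (A B C : plane R) : Prop :=
  (B.1 - A.1) * (C.2 - A.2) = (C.1 - A.1) * (B.2 - A.2).

(* Main.v *)
(* Let P, Q have circumradii r1 <> r2 and let L1, L2 be the distances from M
   to O1, O2.  For n >= 3 the squared distances from M to the vertices of P have
   mean L1^2 + r1^2 and mean square (L1^2 + r1^2)^2 + 2 L1^2 r1^2.  Hence M has
   equal distances only if L1^2 + r1^2 = L2^2 + r2^2 and L1 r1 = L2 r2, which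
   forces L1 = r2 and L2 = r1.  So M is one of the two common points of the
   circles (O1, r2) and (O2, r1).  These are the reflections of V in the
   perpendicular bisector of O1 O2 and in the midpoint of O1 O2; each does have
   equal distances, since the vertices obtained from V by rotating through the
   angle x about O1 and through x (resp. -x) about O2 are equidistant from it. *)

Require Import Defs.
From mathcomp Require Import all_boot all_order all_algebra.
From mathcomp Require Import all_classical all_reals all_analysis.
From mathcomp Require Import ring lra.

Set Implicit Arguments.
Unset Strict Implicit.
Unset Printing Implicit Defensive.

Import Order.TTheory GRing.Theory Num.Theory.
Local Open Scope classical_set_scope.
Local Open Scope ring_scope.

(** * Squared distances *)

Definition sqdist (R : realType) (A B : plane R) : R :=
  (A.1 - B.1) ^+ 2 + (A.2 - B.2) ^+ 2.

Lemma sqdist_ge0 (R : realType) (A B : plane R) : 0 <= sqdist A B.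
Proof. by rewrite addr_ge0 ?sqr_ge0. Qed.

Lemma sqdist_eq0 (R : realType) (A B : plane R) : sqdist A B = 0 -> A = B.
Proof.
move=> /eqP; rewrite paddr_eq0 ?sqr_ge0// !sqrf_eq0 !subr_eq0.
by case: A B => [a1 a2] [b1 b2] /= /andP[/eqP-> /eqP->].
Qed.

Lemma sqr_dist (R : realType) (A B : plane R) : dist A B ^+ 2 = sqdist A B.
Proof. exact/sqr_sqrtr/sqdist_ge0. Qed.

(** * Trigonometric sums over equally spaced angles *)

(** The sum telescopes, by 2 sin h cos y = sin (y + h) - sin (y - h). *)
Lemma mul_sin_sum_cos (R : realType) (x h : R) (n : nat) :
  2 * sin h * (\sum_(k < n) cos (x + 2 * h * k%:R)) =
  sin (x + 2 * h * n%:R - h) - sin (x - h).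
Proof.
elim: n => [|n IHn]; first by rewrite big_ord0 !mulr0 addr0 subrr.
rewrite big_ord_recr /= mulrDr IHn.
have -> : x + 2 * h * n.+1%:R - h = (x + 2 * h * n%:R) + h.
  by rewrite -(@natr1 _ n); ring.
by set y := x + 2 * h * n%:R; rewrite (sinD y h) (sinB y); ring.
Qed.

Lemma cosD2pin (R : realType) (x : R) (m : nat) :
  cos (x + 2 * pi * m%:R) = cos x.
Proof.
rewrite -[RHS](periodicn (@cosD2pi R) m); congr cos.
by rewrite -mulr_natr -(mulr_natr pi); ring.
Qed.

Lemma sinD2pin (R : realType) (x : R) (m : nat) :
  sin (x + 2 * pi * m%:R) = sin x.
Proof.
rewrite -[RHS](periodicn (@sinD2pi R) m); congr sin.
by rewrite -mulr_natr -(mulr_natr pi); ring.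
Qed.

(** For h = j pi / n the telescoped sum compares two angles that are j full turns apart, and sin h
    is nonzero since 0 < h < pi. *)
Lemma sum_cos_multiple (R : realType) (n j : nat) (x : R) :
  (0 < j < n)%N -> \sum_(k < n) cos (x + j%:R * (2 * pi * k%:R / n%:R)) = 0.
Proof.
move=> /andP[j_gt0 ltjn].
have n_gt0 : 0 < n%:R :> R by rewrite ltr0n (leq_trans _ ltjn).
have n_neq0 : n%:R != 0 :> R by rewrite gt_eqF.
pose h : R := j%:R * pi / n%:R.
have sin_h : sin h != 0.
  rewrite gt_eqF// sin_gt0_pi// divr_gt0 ?mulr_gt0 ?(ltr0n _ j) ?pi_gt0//=.
  by rewrite ltr_pdivrMr// mulrC ltr_pM2l ?pi_gt0// ltr_nat.
have := mul_sin_sum_cos x h n.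
have -> : x + 2 * h * n%:R - h = x - h + 2 * pi * j%:R.
  by rewrite /h; field.
rewrite sinD2pin subrr => /eqP; rewrite !mulf_eq0 pnatr_eq0/= (negPf sin_h)/=.
move=> /eqP s0; rewrite -[RHS]s0; apply: eq_bigr => k _; congr (cos (_ + _)).
by rewrite /h; field.
Qed.

Lemma sum_sin_multiple (R : realType) (n j : nat) (x : R) :
  (0 < j < n)%N -> \sum_(k < n) sin (x + j%:R * (2 * pi * k%:R / n%:R)) = 0.
Proof.
move=> lt0jn; rewrite -[RHS](sum_cos_multiple (x - pi / 2) lt0jn).
by apply: eq_bigr => k _; rewrite addrAC cosBpihalf.
Qed.

(** Both harmonics sum to zero; for the second one this takes 2 < n. *)
Lemma sum_trig_poly (R : realType) (n : nat) (t C a b c d : R) : (3 <= n)%N ->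
  let x (k : 'I_n) := t + 2 * pi * k%:R / n%:R in
  \sum_(k < n) (C + a * cos (x k) + b * sin (x k) + c * cos (x k *+ 2)
                  + d * sin (x k *+ 2)) = n%:R * C.
Proof.
move=> n_ge3 x.
have x1 k : x k = t + 1%:R * (2 * pi * k%:R / n%:R) by rewrite mul1r.
have x2 k : x k *+ 2 = t *+ 2 + 2%:R * (2 * pi * k%:R / n%:R).
  by rewrite /x; ring.
have n1 : (0 < 1 < n)%N by rewrite (leq_trans _ n_ge3).
have n2 : (0 < 2 < n)%N by [].
rewrite !big_split /= -!mulr_sumr sumr_const card_ord.
under [in a * _]eq_bigr do rewrite x1.
under [in b * _]eq_bigr do rewrite x1.
under [in c * _]eq_bigr do rewrite x2.
under [in d * _]eq_bigr do rewrite x2.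
rewrite !(sum_cos_multiple _ n1, sum_cos_multiple _ n2).
rewrite !(sum_sin_multiple _ n1, sum_sin_multiple _ n2).
by rewrite !mulr0 !addr0 mulr_natl.
Qed.

(** * Power sums of the squared distances to the vertices *)

Lemma regular_ngon_sqradius (R : realType) (n : nat) (O : plane R)
    (P : 'I_n -> plane R) (r t : R) (i : 'I_n) :
  (forall k : 'I_n, P k = (O.1 + r * cos (t + 2 * pi * k%:R / n%:R),
                           O.2 + r * sin (t + 2 * pi * k%:R / n%:R))) ->
  sqdist (P i) O = r ^+ 2.
Proof.
move=> ->; rewrite /sqdist /= !(addrC O.1, addrC O.2) !addrK.
by rewrite !exprMn -mulrDr cos2Dsin2 mulr1.
Qed.

Lemma sum_sqdist (R : realType) (n : nat) (O V M : plane R)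
    (P : 'I_n -> plane R) :
  (3 <= n)%N -> regular_ngon O P -> range P V ->
  \sum_(k < n) sqdist M (P k) = n%:R * (sqdist M O + sqdist V O) /\
  \sum_(k < n) sqdist M (P k) ^+ 2 =
    n%:R * ((sqdist M O + sqdist V O) ^+ 2 + 2 * (sqdist M O * sqdist V O)).
Proof.
move=> n_ge3 [r [t [_ HP]]] [i _ <-]; rewrite (regular_ngon_sqradius i HP).
set m1 := M.1 - O.1; set m2 := M.2 - O.2; set A := sqdist M O + r ^+ 2.
have dE k : sqdist M (P k) = A
    + (- 2 * r * m1) * cos (t + 2 * pi * k%:R / n%:R)
    + (- 2 * r * m2) * sin (t + 2 * pi * k%:R / n%:R).
  rewrite HP /A /sqdist /= /m1 /m2; set x := t + _.
  transitivity ((M.1 - O.1) ^+ 2 + (M.2 - O.2) ^+ 2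
    + r ^+ 2 * (cos x ^+ 2 + sin x ^+ 2)
    - 2 * r * (M.1 - O.1) * cos x - 2 * r * (M.2 - O.2) * sin x); first by ring.
  by rewrite cos2Dsin2; ring.
split.
  rewrite -(@sum_trig_poly R n t A (- 2 * r * m1) (- 2 * r * m2) 0 0)//.
  by apply: eq_bigr => k _; rewrite dE !mul0r !addr0.
(* Coefficients of the squared distance's square after passing to the double angle; this adds 2 r^2
   (m1^2 + m2^2) to the constant term A^2. *)
rewrite -(@sum_trig_poly R n t _ (- 4 * A * r * m1) (- 4 * A * r * m2)
  (2 * r ^+ 2 * (m1 ^+ 2 - m2 ^+ 2)) (4 * r ^+ 2 * m1 * m2))//.
apply: eq_bigr => k _; rewrite dE sin_mulr2n cos_mulr2n /A /sqdist -/m1 -/m2.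
set x := t + _; have := sin2cos2 x.
set c := cos x; set s := sin x => s2.
transitivity ((m1 ^+ 2 + m2 ^+ 2 + r ^+ 2) ^+ 2
  - 4 * (m1 ^+ 2 + m2 ^+ 2 + r ^+ 2) * r * (m1 * c + m2 * s)
  + 4 * r ^+ 2 * (m1 ^+ 2 * c ^+ 2 + m2 ^+ 2 * s ^+ 2 + 2 * m1 * m2 * c * s)).
  by ring.
by rewrite s2; ring.
Qed.

Lemma equal_distances_sqdist (R : realType) (n : nat) (P Q : 'I_n -> plane R)
    (O1 O2 V M : plane R) :
  (3 <= n)%N -> regular_ngon O1 P -> regular_ngon O2 Q ->
  range P V -> range Q V -> sqdist V O1 != sqdist V O2 ->
  equal_distances P Q M ->
  sqdist M O1 = sqdist V O2 /\ sqdist M O2 = sqdist V O1.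
Proof.
move=> n_ge3 regP regQ VP VQ neq PQ.
(* Applied below to squares and fourth powers of the distances. *)
have sum_eq (f : R -> R) :
    \sum_(k < n) f (dist M (P k)) = \sum_(k < n) f (dist M (Q k)).
  have sumE S : \sum_(x <- distances M S) f x = \sum_(k < n) f (dist M (S k)).
    by rewrite /distances big_map big_enum.
  by rewrite -!sumE; exact: perm_big.
have [P1 P2] := sum_sqdist M n_ge3 regP VP.
have [Q1 Q2] := sum_sqdist M n_ge3 regQ VQ.
have n_neq0 : n%:R != 0 :> R by rewrite pnatr_eq0 -lt0n (leq_trans _ n_ge3).
have /(mulfI n_neq0) e1 : n%:R * (sqdist M O1 + sqdist V O1)
    = n%:R * (sqdist M O2 + sqdist V O2).
  rewrite -P1 -Q1; have := sum_eq (fun x => x ^+ 2).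
  by under eq_bigr do rewrite sqr_dist; under [RHS]eq_bigr do rewrite sqr_dist.
have /(mulfI n_neq0) : n%:R * ((sqdist M O1 + sqdist V O1) ^+ 2
      + 2 * (sqdist M O1 * sqdist V O1))
    = n%:R * ((sqdist M O2 + sqdist V O2) ^+ 2
      + 2 * (sqdist M O2 * sqdist V O2)).
  rewrite -P2 -Q2; have := sum_eq (fun x => (x ^+ 2) ^+ 2).
  by under eq_bigr do rewrite sqr_dist; under [RHS]eq_bigr do rewrite sqr_dist.
rewrite e1 => /addrI /(mulfI _) e2.
have {}e2 : sqdist M O1 * sqdist V O1 = sqdist M O2 * sqdist V O2.
  by apply: e2; rewrite pnatr_eq0.
move: neq e1 e2.
set p := sqdist V O1; set q := sqdist V O2.
set x := sqdist M O1; set y := sqdist M O2 => neq e1 e2.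
have yE : y = x + p - q by rewrite e1 addrK.
(* The pairs x, p and y, q have the same sum and product, hence agree up to order; p <> q leaves x =
   q. *)
have : (x - q) * (p - q) = 0.
  have -> : (x - q) * (p - q) = x * p - (x + p - q) * q by ring.
  by rewrite -yE e2 subrr.
move/eqP; rewrite mulf_eq0 !subr_eq0 (negPf neq) orbF => /eqP xq.
by split=> //; rewrite yE xq addrAC subrr add0r.
Qed.

(** * The common points of the two swapped circles *)

(* The reflection of V in the perpendicular bisector of O1 O2: with V, O1, O2 it
   forms an isosceles trapezoid. *)
Definition trapezoid_point (R : realType) (V O1 O2 : plane R) : plane R :=
  let l := (sqdist V O1 - sqdist V O2) / sqdist O2 O1 in
  (V.1 - l * (O2.1 - O1.1), V.2 - l * (O2.2 - O1.2)).

Definition parallelogram_point (R : realType) (V O1 O2 : plane R) : plane R :=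
  (O1.1 + O2.1 - V.1, O1.2 + O2.2 - V.2).

(** Subtracting the circle equations fixes the inner product of M - V with O2 - O1. The cross
    product [p] then solves a quadratic with roots 0 (trapezoid) and [w] (parallelogram). *)
Lemma swapped_circles_meet (R : realType) (V O1 O2 M : plane R) :
  sqdist O2 O1 != 0 ->
  sqdist M O1 = sqdist V O2 -> sqdist M O2 = sqdist V O1 ->
  M = trapezoid_point V O1 O2 \/ M = parallelogram_point V O1 O2.
Proof.
case: V O1 O2 M => [v1 v2] [a1 a2] [b1 b2] [x y].
rewrite /trapezoid_point /parallelogram_point /sqdist /=.
set N := (b1 - a1) ^+ 2 + (b2 - a2) ^+ 2 => N0 e1 e2.
pose u1 := b1 - a1; pose u2 := b2 - a2.
pose D : R := (v1 - a1) ^+ 2 + (v2 - a2) ^+ 2 - ((v1 - b1) ^+ 2 + (v2 - b2) ^+ 2).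
pose p : R := (y - v2) * u1 - (x - v1) * u2.
pose w : R := (a2 + b2 - v2 - v2) * u1 - (a1 + b1 - v1 - v1) * u2.
have inner : (x - v1) * u1 + (y - v2) * u2 = - D.
  suff : 2 * ((x - v1) * u1 + (y - v2) * u2 + D) = 0 by lra.
  transitivity (((x - a1) ^+ 2 + (y - a2) ^+ 2)
      - ((x - b1) ^+ 2 + (y - b2) ^+ 2) + D); first by rewrite /D /u1 /u2; ring.
  by rewrite e1 e2 /D; ring.
have : p * (p - w) = 0.
  pose q := (x - v1) * u1 + (y - v2) * u2.
  transitivity (N * ((x - a1) ^+ 2 + (y - a2) ^+ 2
      - ((v1 - b1) ^+ 2 + (v2 - b2) ^+ 2)) - (q + D) * (q + N)).
    by rewrite /N /p /w /q /D /u1 /u2; ring.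
  by rewrite e1 subrr /q inner addNr mulr0 mul0r subrr.
(* M - V is recovered from its inner and cross products with O2 - O1. *)
have solve (q : R) : p = q ->
    x = v1 + (- D * u1 - q * u2) / N /\ y = v2 + (- D * u2 + q * u1) / N.
  move=> <-; rewrite -inner /p.
  by split; rewrite -/u1 -/u2 /N /u1 /u2; field.
move=> /eqP; rewrite mulf_eq0 (subr_eq0 p w) => /orP[] /eqP e.
  by left; have [-> ->] := solve _ e; congr pair; rewrite -/D /u1 /u2; field.
right; have [-> ->] := solve _ e.
by congr pair; rewrite /w /D /u1 /u2 /N; field.
Qed.

Lemma trapezoid_parallelogram_collinear (R : realType) (V O1 O2 : plane R) :
  sqdist O2 O1 != 0 ->
  trapezoid_point V O1 O2 = parallelogram_point V O1 O2 <-> collinear V O1 O2.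
Proof.
case: V O1 O2 => [v1 v2] [a1 a2] [b1 b2].
rewrite /trapezoid_point /parallelogram_point /collinear /sqdist /=.
set N := (b1 - a1) ^+ 2 + (b2 - a2) ^+ 2 => N0.
set D := _ - ((v1 - b1) ^+ 2 + _).
(* Twice the signed area of V O1 O2. By [e1] and [e2] the two points differ by 2 w / N times O2 - O1
   turned by a right angle. *)
pose w : R := (a1 - v1) * (b2 - v2) - (b1 - v1) * (a2 - v2).
have e1 : v1 - D / N * (b1 - a1) = a1 + b1 - v1 - 2 * w * (b2 - a2) / N.
  by rewrite /w /D /N; field.
have e2 : v2 - D / N * (b2 - a2) = a2 + b2 - v2 + 2 * w * (b1 - a1) / N.
  by rewrite /w /D /N; field.
rewrite e1 e2; split=> [[] /eqP|wE].
  rewrite -subr_eq0 addrAC subrr add0r => /eqP w1 /eqP.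
  rewrite -subr_eq0 addrAC subrr add0r => /eqP w2.
  apply/eqP; rewrite -subr_eq0 -/w; apply/eqP.
  transitivity ((2 * w * (b1 - a1) / N * (b1 - a1)
     - (- (2 * w * (b2 - a2) / N)) * (b2 - a2)) / 2).
    by rewrite /N; field.
  by rewrite w1 w2 !mul0r subrr mul0r.
have -> : w = 0 by rewrite /w wE subrr.
by rewrite !(mulr0, mul0r) subr0 addr0.
Qed.

(** * Rigid motions, congruence and rotations of the shared vertex *)

(** Rotation through [x] carrying [O] to [O']: with distinct centres it superposes polygons, with
    [O' = O] it rotates about [O]. *)
Definition rigid_motion (R : realType) (x : R) (O O' A : plane R) : plane R :=
  (O'.1 + (cos x * (A.1 - O.1) - sin x * (A.2 - O.2)),
   O'.2 + (sin x * (A.1 - O.1) + cos x * (A.2 - O.2))).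

Lemma isometry_rigid_motion (R : realType) (x : R) (O O' : plane R) :
  Defs.isometry (rigid_motion x O O').
Proof.
move=> A B; rewrite /dist /rigid_motion /=; congr Num.sqrt.
transitivity ((cos x ^+ 2 + sin x ^+ 2)
  * ((A.1 - B.1) ^+ 2 + (A.2 - B.2) ^+ 2)); first by ring.
by rewrite cos2Dsin2 mul1r.
Qed.

Lemma rigid_motion_polar (R : realType) (r t x : R) (O O' : plane R) :
  rigid_motion x O O' (O.1 + r * cos t, O.2 + r * sin t) =
  (O'.1 + r * cos (t + x), O'.2 + r * sin (t + x)).
Proof.
by rewrite /rigid_motion /= cosD sinD; congr pair; ring.
Qed.

Lemma regular_ngon_congruent (R : realType) (n : nat) (P Q : 'I_n -> plane R)
    (O1 O2 V : plane R) :
  regular_ngon O1 P -> regular_ngon O2 Q -> range P V -> range Q V ->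
  sqdist V O1 = sqdist V O2 -> congruent P Q.
Proof.
move=> [r1 [t1 [r1_gt0 HP]]] [r2 [t2 [r2_gt0 HQ]]] [i _ iV] [j _ jV].
rewrite -{1}iV -jV (regular_ngon_sqradius i HP) (regular_ngon_sqradius j HQ).
move=> /eqP; rewrite eqrXn2 ?ltW// => /eqP r12.
exists (rigid_motion (t2 - t1) O1 O2); split.
  exact: isometry_rigid_motion.
rewrite image_comp; congr image; apply/funext => k /=.
rewrite HP HQ rigid_motion_polar r12.
by rewrite [t1 + _ + _]addrC addrA subrK.
Qed.

(** If V is vertex i, rotating it through k steps gives vertex i + k mod n; the discarded quotient
    counts full turns. *)
Lemma regular_ngon_rotation (R : realType) (n : nat) (P : 'I_n -> plane R)
    (O V : plane R) :
  regular_ngon O P -> range P V ->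
  exists2 s : 'I_n -> 'I_n, injective s &
    forall k : 'I_n, P (s k) = rigid_motion (2 * pi * k%:R / n%:R) O O V.
Proof.
move=> [r [t [_ HP]]] [i _ <-].
have n_gt0 : (0 < n)%N by rewrite (leq_ltn_trans _ (ltn_ord i)).
have n_neq0 : n%:R != 0 :> R by rewrite pnatr_eq0 -lt0n.
exists (fun k => Ordinal (ltn_pmod (i + k) n_gt0)).
  move=> k l [] /eqP; rewrite eqn_modDl !modn_small ?ltn_ord// => /eqP.
  exact: val_inj.
move=> k; rewrite (HP i) rigid_motion_polar HP /=.
set q := ((i + k) %/ n)%N; set m := ((i + k) %% n)%N.
have -> : t + 2 * pi * i%:R / n%:R + 2 * pi * k%:R / n%:R =
          t + 2 * pi * m%:R / n%:R + 2 * pi * q%:R.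
  have ik : i%:R + k%:R = q%:R * n%:R + m%:R :> R.
    by rewrite -natrM -!natrD -divn_eq.
  transitivity (t + 2 * pi * (i%:R + k%:R) / n%:R); first by field.
  by rewrite ik; field.
by rewrite cosD2pin sinD2pin.
Qed.

Lemma perm_eq_map_inj (n : nat) (T : eqType) (s : 'I_n -> 'I_n) (f : 'I_n -> T) :
  injective s ->
  perm_eq [seq f k | k <- enum 'I_n] [seq f (s k) | k <- enum 'I_n].
Proof.
move=> s_inj; rewrite (map_comp f s) perm_map//.
apply: uniq_perm => [||k]; first exact: enum_uniq.
  by rewrite (map_inj_uniq s_inj) enum_uniq.
rewrite mem_enum; apply/esym/mapP; exists (invF s_inj k); first exact: mem_enum.
by rewrite f_invF.
Qed.

Lemma distances_rotation (R : realType) (n : nat) (P : 'I_n -> plane R)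
    (O V M : plane R) :
  regular_ngon O P -> range P V ->
  perm_eq (distances M P)
    (distances M (fun k : 'I_n => rigid_motion (2 * pi * k%:R / n%:R) O O V)).
Proof.
move=> regP VP; have [s s_inj sE] := regular_ngon_rotation regP VP.
apply: perm_trans (perm_eq_map_inj _ s_inj) _.
by rewrite /distances; under eq_map do rewrite sE.
Qed.

(** Reindexing by k -> n - k mod n reverses the sense of rotation, as the parallelogram point
    requires. *)
Lemma distances_rotationN (R : realType) (n : nat) (O V M : plane R) :
  perm_eq
    (distances M (fun k : 'I_n => rigid_motion (2 * pi * k%:R / n%:R) O O V))
    (distances M (fun k : 'I_n => rigid_motion (- (2 * pi * k%:R / n%:R)) O O V)).
Proof.
have opp_lt (k : 'I_n) : ((n - k) %% n < n)%N.
  by rewrite ltn_pmod// (leq_ltn_trans _ (ltn_ord k)).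
have opp_inj : injective (fun k => Ordinal (opp_lt k)).
  (* Adding k + l turns n - k and n - l into n + l and n + k. *)
  move=> k l [] /eqP; rewrite -(eqn_modDr (k + l)).
  rewrite addnA (subnK (ltnW (ltn_ord k))).
  rewrite (addnC k) addnA (subnK (ltnW (ltn_ord l))).
  by rewrite !modnDl !modn_small// => /eqP /val_inj ->.
apply: perm_trans (perm_eq_map_inj _ opp_inj) _.
rewrite /distances; under eq_map => k.
  have n_neq0 : n%:R != 0 :> R.
    by rewrite pnatr_eq0 -lt0n (leq_ltn_trans _ (ltn_ord k)).
  have -> : rigid_motion (2 * pi * (Ordinal (opp_lt k))%:R / n%:R) O O V =
            rigid_motion (- (2 * pi * k%:R / n%:R)) O O V.
    rewrite /=; set q := ((n - k) %/ n)%N; set m := ((n - k) %% n)%N.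
    (* Here q is 1 for k = 0 and 0 otherwise. *)
    have -> : - (2 * pi * k%:R / n%:R) =
      2 * pi * m%:R / n%:R + 2 * pi * q%:R - 2 * pi * 1%:R :> R.
      have nk : n%:R - k%:R = q%:R * n%:R + m%:R :> R.
        by rewrite -natrM -natrD -divn_eq (natrB _ (ltnW (ltn_ord k))).
      have -> : m%:R = n%:R - k%:R - q%:R * n%:R :> R by rewrite nk addrC addKr.
      by field.
    rewrite /rigid_motion.
    rewrite -[in RHS](cosD2pin _ 1) -[in RHS](sinD2pin _ 1) subrK.
    by rewrite cosD2pin sinD2pin.
  over.
by [].
Qed.

(** * Equal distances at the two points *)

(** The reflection swaps V with M and O1 with O2, so the oriented angles from V to M at O1 and O2
    agree; equal rotations of V keep the triangles congruent. *)
Lemma dist_trapezoid_point (R : realType) (x : R) (O1 O2 V : plane R) :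
  sqdist O2 O1 != 0 ->
  dist (trapezoid_point V O1 O2) (rigid_motion x O1 O1 V) =
  dist (trapezoid_point V O1 O2) (rigid_motion x O2 O2 V).
Proof.
rewrite /dist /trapezoid_point /rigid_motion /sqdist /= => O12.
congr Num.sqrt; have := sin2cos2 x; set c := cos x; set s := sin x => s2.
apply/eqP; rewrite -subr_eq0; apply/eqP.
set D := _ - ((V.1 - O2.1) ^+ 2 + _); set N := _ + _ in O12 *.
transitivity (2 * (1 - c) * (D - D / N * N) + (s ^+ 2 - (1 - c ^+ 2)) * D).
  by rewrite /D /N; field.
by rewrite divfK// s2 !subrr mulr0 mul0r addr0.
Qed.

(** Here the oriented angles from V to M at O1 and O2 are opposite, so opposite rotations are
    needed. *)
Lemma dist_parallelogram_point (R : realType) (x : R) (O1 O2 V : plane R) :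
  dist (parallelogram_point V O1 O2) (rigid_motion x O1 O1 V) =
  dist (parallelogram_point V O1 O2) (rigid_motion (- x) O2 O2 V).
Proof.
rewrite /dist /parallelogram_point /rigid_motion /= cosN sinN.
congr Num.sqrt; have := sin2cos2 x; set c := cos x; set s := sin x => s2.
apply/eqP; rewrite -subr_eq0; apply/eqP.
transitivity ((s ^+ 2 - (1 - c ^+ 2)) * ((V.1 - O1.1) ^+ 2
  + (V.2 - O1.2) ^+ 2 - ((V.1 - O2.1) ^+ 2 + (V.2 - O2.2) ^+ 2))).
  by ring.
by rewrite s2 subrr mul0r.
Qed.

Lemma equal_distances_trapezoid (R : realType) (n : nat) (P Q : 'I_n -> plane R)
    (O1 O2 V : plane R) :
  regular_ngon O1 P -> regular_ngon O2 Q -> range P V -> range Q V ->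
  sqdist O2 O1 != 0 -> equal_distances P Q (trapezoid_point V O1 O2).
Proof.
move=> regP regQ VP VQ O12; rewrite /equal_distances.
rewrite (permPl (distances_rotation _ regP VP)).
rewrite (permPr (distances_rotation _ regQ VQ)).
rewrite /distances; under eq_map do rewrite (dist_trapezoid_point _ _ O12).
by [].
Qed.

Lemma equal_distances_parallelogram (R : realType) (n : nat)
    (P Q : 'I_n -> plane R) (O1 O2 V : plane R) :
  regular_ngon O1 P -> regular_ngon O2 Q -> range P V -> range Q V ->
  equal_distances P Q (parallelogram_point V O1 O2).
Proof.
move=> regP regQ VP VQ; rewrite /equal_distances.
rewrite (permPl (distances_rotation _ regP VP)).
rewrite (permPr (distances_rotation _ regQ VQ)).
rewrite (permPr (distances_rotationN _ _ _ _)).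
by rewrite /distances; under eq_map do rewrite dist_parallelogram_point.
Qed.

(* If V, O1, O2 are collinear, the two points merge into one: for the squares
   with centres (1,0), (2,0) and common vertex (0,0), only (3,0) has equal
   distances.  So the two points are distinct exactly when V is not on the
   line of centres. *)
Theorem theorem5p1 (R : realType) (n : nat) (P Q : 'I_n -> plane R)
    (O1 O2 V : plane R)
    (n_ge3 : (3 <= n)%N)
    (regP : regular_ngon O1 P) (regQ : regular_ngon O2 Q)
    (ncongPQ : ~ congruent P Q)
    (VP : range P V) (VQ : range Q V) :
  exists M1 M2 : plane R,
    equal_distances P Q M1 /\
    equal_distances P Q M2 /\
    (forall M : plane R, equal_distances P Q M -> M = M1 \/ M = M2) /\
    (M1 = M2 <-> collinear V O1 O2).
Proof.
have neq : sqdist V O1 != sqdist V O2.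
  apply/eqP => r12; exact/ncongPQ/(regular_ngon_congruent regP regQ VP VQ r12).
have O12 : sqdist O2 O1 != 0.
  (* Concentric polygons through V would have equal radii. *)
  by apply: contra neq => /eqP /sqdist_eq0 ->.
exists (trapezoid_point V O1 O2), (parallelogram_point V O1 O2).
split; first exact: equal_distances_trapezoid.
split; first exact: equal_distances_parallelogram.
split; last exact: trapezoid_parallelogram_collinear.
move=> M PQM.
have [M1 M2] := equal_distances_sqdist n_ge3 regP regQ VP VQ neq PQM.
exact: swapped_circles_meet.
Qed.
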